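(* Let $(S,p)$ be a numerically Gorenstein (isolated, complex) surface singularity with link $Y$, and let $\xi_{can}$ be the canonical contact structure on $Y$. Then $\xi_{can}$, considered as a real plane bundle over $Y$, is trivial.
   Context: Let $(S,p)$ be an isolated complex surface singularity. Embed a neighborhood of $p$ in some $\mathbb{C}^N$ with $p=0$; the link $Y$ is the closed oriented 3-manifold obtained by intersecting $S$ with a sufficiently small sphere centered at $0$ (oriented as the boundary of a neighborhood of $p$ in $S$). The canonical (Milnor fillable) contact structure $\xi_{can}$ on $Y$ is the oriented plane field of complex tangencies $\xi_{can}=TY\cap J(TY)$, where $J$ is the complex structure on $S\setminus\{p\}$; it is a positive co-orientable contact structure, unique up to isomorphism. The singularity $(S,p)$ is called numerically Gorenstein if the holomorphic tangent bundle of $S\setminus\{p\}$ is smoothly trivial (as a complex vector bundle) on a punctured neighborhood of $p$; equivalently, the canonical line bundle $K_S=\Lambda^2T^*S$ is smoothly trivial on a punctured neighborhood of $p$. *)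

(* Defs.v *)
From HB Require Import structures.
From mathcomp Require Import all_boot all_order all_algebra.
From mathcomp Require Import all_classical all_reals all_analysis.
From mathcomp Require Import complex.
Set Implicit Arguments.
Unset Strict Implicit.
Unset Printing Implicit Defensive.
Import Order.TTheory GRing.Theory Num.Theory.
Import numFieldNormedType.Exports.
Local Open Scope classical_set_scope.
Local Open Scope ring_scope.

(* R[i], packed as a structure so that it and 'rV[Cplx R]_N get the canonical
   norm topology that MathComp-Analysis puts on every numFieldType. *)
Definition Cplx (R : realType) : numClosedFieldType := R[i].

Definition rc (R : realType) (r : R) : Cplx R := (r%:C)%C.

Section Defs.
Variable R : realType.
Local Notation C := (Cplx R).

(* Complex differentiability on a neighbourhood; as in
   many texts, C^1 is part of the definition of holomorphic (by Goursat and
   Hartogs, continuity of the differential is automatic). *)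
Definition holomorphic_near N k (f : 'rV[C]_N -> 'rV[C]_k) (x : 'rV[C]_N) :=
  \forall z \near x, differentiable f z /\
    forall v, {for z, continuous (fun y => 'd f y v)}.

Definition analytic_at N (S : set 'rV[C]_N) (x : 'rV[C]_N) :=
  exists k (f : 'rV[C]_N -> 'rV[C]_k),
    holomorphic_near f x /\ \forall z \near x, S z <-> f z = 0.

(* Near x, S is a complex submanifold of dimension d. *)
Definition submanifold_at N (S : set 'rV[C]_N) (d : nat) (x : 'rV[C]_N) :=
  exists k (f : 'rV[C]_N -> 'rV[C]_k),
    [/\ (k + d)%N = N, holomorphic_near f x,
        \forall z \near x, S z <-> f z = 0,
        S x & forall w, exists v, 'd f x v = w].

(* The reduced germ at 0 of an analytic set in C^N; since 0 is a limit point,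
   the germ has pure dimension 2.  The origin may be a smooth point. *)
Definition isolated_surface_singularity N (S : set 'rV[C]_N) :=
  [/\ S 0, limit_point S 0, analytic_at S 0 &
      \forall x \near (0 : 'rV[C]_N)^', S x -> submanifold_at S 2 x].

(* Velocities at x of curves in M.  At a point where M is a real submanifold,
   differentiability at t = 0 alone already gives the usual tangent space. *)
Definition tangent N (M : set 'rV[C]_N) (x : 'rV[C]_N) : set 'rV[C]_N :=
  [set v | exists c : R -> 'rV[C]_N,
     [/\ c 0 = x, \forall t \near (0 : R), M (c t) &
         rc t^-1 *: (c t - x) @[t --> (0 : R)^'] --> v]].

Definition real_derivative_at N k (f : 'rV[C]_N -> 'rV[C]_k)
    (x v : 'rV[C]_N) (l : 'rV[C]_k) :=
  rc t^-1 *: (f (x + rc t *: v) - f x) @[t --> (0 : R)^'] --> l.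

(* f is of class C^n on the open set U, in the real sense: iterated real
   directional derivatives up to order n exist and are continuous. *)
Fixpoint Ck N k (n : nat) (U : set 'rV[C]_N) (f : 'rV[C]_N -> 'rV[C]_k) : Prop :=
  (forall x, U x -> {for x, continuous f}) /\
  if n is n'.+1 then
    forall v, exists2 g : 'rV[C]_N -> 'rV[C]_k,
      (forall x, U x -> real_derivative_at f x v (g x)) & Ck n' U g
  else True.

(* Smoothness on an arbitrary subset B: local extension to C^oo maps. *)
Definition smooth_on N k (B : set 'rV[C]_N) (s : 'rV[C]_N -> 'rV[C]_k) :=
  forall x, B x -> exists (U : set 'rV[C]_N) (g : 'rV[C]_N -> 'rV[C]_k),
    [/\ open U, U x, (forall n, Ck n U g) &
        forall y, B y -> U y -> s y = g y].

(* The family of subspaces E of C^N over B is smoothly trivial of rank r over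
   the scalars K (embedded in C by iota): (x, c) |-> \sum_i c_i s_i(x) is a
   smooth fibrewise isomorphism from B * K^r onto E. *)
Definition trivial_bundle (K : Type) (iota : K -> C) (r : nat) N
    (B : set 'rV[C]_N) (E : 'rV[C]_N -> set 'rV[C]_N) :=
  exists s : 'I_r -> 'rV[C]_N -> 'rV[C]_N,
    (forall i, smooth_on B (s i)) /\
    forall x, B x ->
      (forall c : 'rV[K]_r, E x (\sum_i iota (c 0 i) *: s i x)) /\
      (forall v, E x v ->
         exists! c : 'rV[K]_r, v = \sum_i iota (c 0 i) *: s i x).

Definition trivial_complex_bundle := @trivial_bundle C id.
Definition trivial_real_bundle := @trivial_bundle R (@rc R).

(* The holomorphic tangent bundle is identified, as a complex vector bundle,
   with the real tangent bundle of S \ {0} together with J = 'i. *)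
Definition numerically_gorenstein N (S : set 'rV[C]_N) :=
  exists2 W : set 'rV[C]_N, open_nbhs (0 : 'rV[C]_N) W &
    trivial_complex_bundle 2 (S `&` W `\ 0) (tangent S).

Definition esphere N (e : R) : set 'rV[C]_N :=
  [set z | \sum_i `|z 0 i| ^+ 2 = rc (e ^+ 2)].

Definition transverse_at N (A B : set 'rV[C]_N) (x : 'rV[C]_N) :=
  forall w, exists u v, [/\ tangent A x u, tangent B x v & w = u + v].

(* Y is the link of S cut out by the sphere of radius e.  Transversality, which
   makes Y a 3-manifold, holds for all sufficiently small e (Milnor). *)
Definition is_link N (S : set 'rV[C]_N) (e : R) (Y : set 'rV[C]_N) :=
  Y = S `&` esphere e /\ forall y, Y y -> transverse_at S (esphere e) y.

(* TY \cap J(TY); on the tangent spaces of S, J is multiplication by 'i in C^N. *)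
Definition xi_can N (Y : set 'rV[C]_N) (y : 'rV[C]_N) : set 'rV[C]_N :=
  tangent Y y `&` [set 'i *: v | v in tangent Y y].

End Defs.

(* Main.v *)
(* Each contact plane is the complex line {v in T_yS | <v, y> = 0}.  In a complex
   frame s1, s2 of TS it is spanned over C by w = <s2, y> s1 - <s1, y> s2, which
   does not vanish because the sphere is transverse to S; hence (w, i w) is a real
   frame.  That a vector v of T_yS with Re <v, y> = 0 is the velocity of a curve
   of the link is Lyusternik's theorem for the residual |f(x)| + | |x|^2 - e^2 |,
   where f is a local holomorphic submersion defining S. *)
Require Import Defs.
From HB Require Import structures.
From mathcomp Require Import all_boot all_order all_algebra.
From mathcomp Require Import all_classical all_reals all_analysis.
From mathcomp Require Import complex ring lra.
Set Implicit Arguments.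
Unset Strict Implicit.
Unset Printing Implicit Defensive.
Import Order.TTheory GRing.Theory Num.Theory.
Import numFieldNormedType.Exports.
Local Open Scope classical_set_scope.
Local Open Scope ring_scope.

(** * The norm as a real number *)

Section RealNorm.
Variable R : realType.
Local Notation C := (Cplx R).
Implicit Types (V : normedZmodType C).

(** A curve in the definition of [tangent] has to be differentiable at 0 only, so its points may be
    chosen separately for each [t]: it is enough that the distance from [y + t v] to the link is
    o(t). An error estimate thus takes the place of an implicit function theorem. The equations of
    the link are of two kinds, [f = 0] being complex and the sphere a single real equation, so they
    are corrected separately: a right inverse of ['d f y] corrects [f], and a vector [u] tangent to
    [S] but not to the sphere corrects the radius without disturbing [f] to first order. The
    differential is kept frozen at [y]; strict differentiability there is what makes each correction
    halve the residual. The Hermitian product is conjugate-linear in [y], so the frame is smooth in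
    the real sense only, and the differential calculus is built on products that are bilinear over
    the reals. *)

Lemma rcD (r s : R) : rc (r + s) = rc r + rc s.
Proof. exact: (rmorphD (real_complex R)). Qed.
Lemma rcN (r : R) : rc (- r) = - rc r.
Proof. exact: (rmorphN (real_complex R)). Qed.
Lemma rcM (r s : R) : rc (r * s) = rc r * rc s.
Proof. exact: (rmorphM (real_complex R)). Qed.
Lemma rcV (r : R) : rc r^-1 = (rc r)^-1.
Proof. exact: (fmorphV (real_complex R)). Qed.
Lemma rc0 : rc (0 : R) = 0. Proof. by []. Qed.
Lemma rc1 : rc (1 : R) = 1. Proof. by []. Qed.
Lemma rc_le (r s : R) : (rc r <= rc s) = (r <= s).
Proof. exact: lecR. Qed.
Lemma rc_lt (r s : R) : (rc r < rc s) = (r < s).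
Proof. exact: ltcR. Qed.
Lemma rc_eq0 (r : R) : (rc r == 0) = (r == 0).
Proof. exact: (fmorph_eq0 (real_complex R)). Qed.

Definition re (z : C) : R := complex.Re z.
Definition im (z : C) : R := complex.Im z.

Lemma re_rc r : re (rc r) = r. Proof. by []. Qed.
Lemma im_rc r : im (rc r) = 0. Proof. by []. Qed.
Lemma reD (a b : C) : re (a + b) = re a + re b.
Proof. by case: a b => [? ?] [? ?]. Qed.
Lemma imD (a b : C) : im (a + b) = im a + im b.
Proof. by case: a b => [? ?] [? ?]. Qed.
Lemma reN (a : C) : re (- a) = - re a.
Proof. by case: a. Qed.
Lemma imN (a : C) : im (- a) = - im a.
Proof. by case: a. Qed.
Lemma reZ r (a : C) : re (rc r * a) = r * re a.
Proof. by case: a => x y; rewrite /re /= mul0r subr0. Qed.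
Lemma imZ r (a : C) : im (rc r * a) = r * im a.
Proof. by case: a => x y; rewrite /im /= mul0r addr0. Qed.
Lemma re_mulI (a : C) : re ('i * a) = - im a.
Proof. by rewrite -complexiE /re mulrC ReiNIm. Qed.
Lemma im_mulI (a : C) : im ('i * a) = re a.
Proof. by rewrite -complexiE /im mulrC ImiRe. Qed.
Lemma reim (a : C) : a = rc (re a) + 'i * rc (im a).
Proof. by rewrite {1}[a]complexE complexiE. Qed.

(* The norms of MathComp-Analysis take their values in the scalar field, here
   the partially ordered Cplx R; [rn] is the same norm as a real number. *)
Definition rn V (x : V) : R := complex.Re `|x|.

Lemma normE V (x : V) : `|x| = rc (rn x).
Proof. by rewrite /rc RRe_real // normr_real. Qed.

Lemma rn_ge0 V (x : V) : 0 <= rn x.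
Proof. by rewrite -rc_le -normE rc0. Qed.

Lemma rnD V (x y : V) : rn (x + y) <= rn x + rn y.
Proof. by rewrite -rc_le rcD -!normE ler_normD. Qed.

Lemma rnN V (x : V) : rn (- x) = rn x.
Proof. by rewrite /rn normrN. Qed.

Lemma rnB V (x y : V) : rn (x - y) = rn (y - x).
Proof. by rewrite /rn distrC. Qed.

Lemma rn0 V : rn (0 : V) = 0.
Proof. by rewrite /rn normr0. Qed.

Lemma rn_eq0 V (x : V) : rn x = 0 -> x = 0.
Proof. by move=> x0; apply/eqP; rewrite -normr_eq0 normE x0. Qed.

Lemma rn_triangle V (x y z : V) : rn (x - z) <= rn (x - y) + rn (y - z).
Proof. by rewrite -[x - z](subrKA y) rnD. Qed.

Lemma rnM (a b : C) : rn (a * b) = rn a * rn b.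
Proof. by apply: complexI; rewrite -/(rc _) -/(rc _) rcM -!normE normrM. Qed.

Lemma rnZ (V : normedModType C) a (x : V) : rn (a *: x) = rn a * rn x.
Proof. by apply: complexI; rewrite -/(rc _) -/(rc _) rcM -!normE normrZ. Qed.

Lemma rn_rc (r : R) : rn (rc r) = `|r|.
Proof.
by rewrite /rn /rc normc_def /= expr0n /= addr0 sqrtr_sqr.
Qed.

Lemma rn_i : rn ('i : C) = 1.
Proof. by rewrite /rn normCi. Qed.

Lemma rn_re (a : C) : `|re a| <= rn a.
Proof. by rewrite -rc_le -normE; exact: normc_ge_Re. Qed.

Lemma rn_im (a : C) : `|im a| <= rn a.
Proof.
by have := rn_re ('i * a); rewrite rnM rn_i mul1r re_mulI normrN.
Qed.

Lemma rn_le_reim (a : C) : rn a <= `|re a| + `|im a|.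
Proof.
by rewrite {1}[a]reim; apply: le_trans (rnD _ _) _; rewrite rnM rn_i mul1r !rn_rc.
Qed.

Lemma rn_sum V (I : finType) (F : I -> V) : rn (\sum_i F i) <= \sum_i rn (F i).
Proof.
elim/big_ind2 : _ => [|x a y b xa yb|//]; first by rewrite rn0.
exact: le_trans (rnD _ _) (lerD xa yb).
Qed.

Lemma rn_conj (a : C) : rn (a^*) = rn a.
Proof. by rewrite /rn norm_conjC. Qed.

Lemma rn_coord k (x : 'rV[C]_k) i : rn (x 0 i) <= rn x.
Proof.
rewrite -rc_le -!normE.
have -> : `|x| = mx_norm x by [].
rewrite mx_normE -[leLHS]nngE num_le.
exact: (le_bigmax _ (fun ij => `|x ij.1 ij.2|%:nng) (0, i)).
Qed.

Lemma rn_row_le k (x : 'rV[C]_k) (M : R) : 0 <= M ->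
  (forall i, rn (x 0 i) <= M) -> rn x <= M.
Proof.
move=> M0 xM; have -> : rn x = complex.Re (mx_norm x) by [].
have [->//|/mx_norm_neq0[[i j] ->]] := eqVneq (mx_norm x) 0.
by rewrite ord1; exact: xM.
Qed.

End RealNorm.

(** * Zeros by Newton iteration *)

Section RealTopology.
Variable R : realType.
Local Notation C := (Cplx R).

Lemma gt0_rc (e : C) : 0 < e -> exists2 r : R, 0 < r & e = rc r.
Proof.
move=> e0; have eE : e = rc (re e) by rewrite /rc RRe_real ?gtr0_real.
by exists (re e) => //; rewrite -rc_lt -eE.
Qed.

Lemma near_rn (V : pseudoMetricNormedZmodType C) (x : V) (P : set V) :
  (\forall z \near x, P z) <->
  exists2 r : R, 0 < r & forall z, rn (z - x) < r -> P z.
Proof.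
split=> [/nbhs_normP[e /gt0_rc[r r0 ->] rP]|[r r0 rP]].
  by exists r => // z zx; apply: rP; rewrite /= normE rnB rc_lt.
apply/nbhs_normP; exists (rc r) => /=; first by rewrite -rc0 rc_lt.
by move=> z /=; rewrite normE rnB rc_lt; exact: rP.
Qed.

Lemma cvg_rn (V : pseudoMetricNormedZmodType C) T (F : set_system T) {FF : Filter F}
    (f : T -> V) (a : V) :
  f @ F --> a <-> rn (f t - a) @[t --> F] --> (0 : R).
Proof.
split=> [/cvgrPdist_lt fa|/cvgrPdist_lt fa].
  apply/cvgrPdist_lt => e e0; have /fa : 0 < rc e by rewrite -rc0 rc_lt.
  apply: filterS => t; rewrite normE rc_lt sub0r normrN rnB.
  by rewrite ger0_norm ?rn_ge0.
apply/cvgrPdist_lt => _ /gt0_rc[e /fa fe ->]; apply: filterS fe => t.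
by rewrite normE rc_lt sub0r normrN rnB ger0_norm ?rn_ge0.
Qed.

Lemma cvg0_le T (F : set_system T) {FF : Filter F} (f g : T -> R) :
  (\forall t \near F, 0 <= f t <= g t) -> g @ F --> (0 : R) -> f @ F --> (0 : R).
Proof. by move=> fg g0; exact: (squeeze_cvgr fg (cvg_cst 0) g0). Qed.

Lemma near0_real (P : set R) :
  (\forall t \near (0 : R), P t) <->
  exists2 d : R, 0 < d & forall t, `|t| < d -> P t.
Proof.
split=> [/nbhs_norm0P[d d0 dP]|[d d0 dP]]; first by exists d => // t; apply: dP.
by apply/nbhs_norm0P; exists d => // t; apply: dP.
Qed.

Lemma dnear0_real (P : set R) :
  (\forall t \near (0 : R)^', P t) <->
  exists2 d : R, 0 < d & forall t, t != 0 -> `|t| < d -> P t.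
Proof.
rewrite near_withinE; apply: iff_trans (near0_real _) _.
split=> -[d d0 dP]; exists d => // t.
  by move=> t0 td; exact: dP.
by move=> td t0; exact: dP.
Qed.

(** The intervals with centre [a n] and radius [2 * K / 2 ^+ n], the sum of all remaining
    increments, are nested. The limit is the supremum of their left ends. *)
Lemma geometric_real (a : nat -> R) (K : R) : 0 <= K ->
  (forall n, `|a n.+1 - a n| <= K / 2 ^+ n) ->
  exists l, forall n, `|a n - l| <= 2 * K / 2 ^+ n.
Proof.
move=> K0 aK; pose e n : R := 2 * K / 2 ^+ n.
have eS n : e n = e n.+1 + K / 2 ^+ n.
  by rewrite /e exprS invfM; field; rewrite expf_neq0.
have e0 n : 0 <= e n by rewrite divr_ge0 ?mulr_ge0 ?exprn_ge0.
have step n : (a n - e n <= a n.+1 - e n.+1) /\ (a n.+1 + e n.+1 <= a n + e n).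
  by have := aK n; rewrite ler_norml => /andP[]; rewrite (eS n); split; lra.
have lo : {homo (fun n => a n - e n) : n m / (n <= m)%N >-> n <= m}.
  by apply: homo_leq => //; [exact: le_trans|move=> n; case: (step n)].
have up : {homo (fun n => a n + e n) : n m / (n <= m)%N >-> m <= n}.
  apply: (homo_leq (r := fun x y => y <= x)) => //; last by move=> n; case: (step n).
  by move=> y x z xy yz; exact: le_trans yz xy.
have lu n m : a n - e n <= a m + e m.
  have := lo _ _ (leq_maxl n m); have := up _ _ (leq_maxr n m).
  by have := e0 (maxn n m); lra.
pose A : set R := range (fun n => a n - e n).
have A0 : A !=set0 by exists (a 0%N - e 0%N), 0%N.
have ubA : has_ubound A by exists (a 0%N + e 0%N) => _ [n _ <-].
exists (sup A) => n; rewrite ler_norml; apply/andP; split.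
  suff : sup A <= a n + e n by rewrite /e; lra.
  by apply: ge_sup => // _ [m _ <-].
suff : a n - e n <= sup A by rewrite /e; lra.
by apply: ub_le_sup => //; exists n.
Qed.

(** The factor 4 is 2 for the real part plus 2 for the imaginary part of each coordinate; the norm
    of a row is the maximum over its coordinates. *)
Lemma geometric_row k (x : nat -> 'rV[C]_k) (K : R) : 0 <= K ->
  (forall n, rn (x n.+1 - x n) <= K / 2 ^+ n) ->
  exists l, forall n, rn (x n - l) <= 4 * K / 2 ^+ n.
Proof.
move=> K0 xK.
have coord (p : C -> R) : (forall a b, p (a - b) = p a - p b) ->
    (forall a, `|p a| <= rn a) ->
    forall i, exists l, forall n, `|p (x n 0 i) - l| <= 2 * K / 2 ^+ n.
  move=> pB ple i; apply: geometric_real => // n; rewrite -pB.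
  apply: le_trans (ple _) _; apply: le_trans (xK n).
  by have := rn_coord (x n.+1 - x n) i; rewrite !mxE.
have reB (a b : C) : re (a - b) = re a - re b by rewrite reD reN.
have imB (a b : C) : im (a - b) = im a - im b by rewrite imD imN.
have [lr lrP] := choice (coord (@re R) reB (@rn_re R)).
have [li liP] := choice (coord (@im R) imB (@rn_im R)).
exists (\row_i (rc (lr i) + 'i * rc (li i))) => n.
apply: rn_row_le => [|i]; first by rewrite divr_ge0 ?mulr_ge0 ?exprn_ge0.
rewrite !mxE [x n 0 i]reim.
rewrite (_ : _ - _ = rc (re (x n 0 i) - lr i) + 'i * rc (im (x n 0 i) - li i)); last first.
  by rewrite !rcD !rcN; ring.
apply: le_trans (rnD _ _) _; rewrite rnM rn_i mul1r !rn_rc.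
apply: le_trans (lerD (lrP i n) (liP i n)) _.
by rewrite -!mulrA -mulrDl; apply: ler_wpM2r; [rewrite divr_ge0 ?exprn_ge0|lra].
Qed.

(* Newton iteration: each step halves the residual [g] and moves by at most
   [M * g], so the iterates converge geometrically to a zero of [g]. *)
Lemma zero_near k (g : 'rV[C]_k -> R) (y : 'rV[C]_k) (r M L : R) :
  0 <= M -> (forall x, 0 <= g x) ->
  (forall x x', rn (x - y) < r -> rn (x' - y) < r -> g x <= g x' + L * rn (x - x')) ->
  (forall x, rn (x - y) < r -> exists2 x', rn (x' - x) <= M * g x &
     rn (x' - y) < r -> g x' <= g x / 2) ->
  forall x, rn (x - y) + 4 * M * g x < r ->
    exists2 z, g z = 0 & rn (z - x) <= 4 * M * g x.
Proof.
move=> M0 g0 gL gstep x xr.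
have [F FP] : {F : 'rV[C]_k -> 'rV[C]_k & forall x, rn (x - y) < r ->
    rn (F x - x) <= M * g x /\ (rn (F x - y) < r -> g (F x) <= g x / 2)}.
  apply: (@choice _ _ (fun x x' => rn (x - y) < r ->
    rn (x' - x) <= M * g x /\ (rn (x' - y) < r -> g x' <= g x / 2))) => z.
  (* Outside the ball the requirement is void and [z] itself is the default value. *)
  have [zr|zr] := pselect (rn (z - y) < r); last by exists z.
  by have [x' ? ?] := gstep z zr; exists x'.
pose u n := iter n F x.
pose d n : R := M * g x / 2 ^+ n.
have d0 n : 0 <= d n by rewrite divr_ge0 ?mulr_ge0 ?exprn_ge0.
have dS n : d n = 2 * d n.+1 by rewrite /d exprS; field; rewrite expf_neq0.
have d00 : d 0%N = M * g x by rewrite /d expr0 divr1.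
(* [2 * d 0 - 2 * d n] is the sum of the first [n] step bounds. It never exceeds [2 * M * g x], so
   the iterates stay in the ball. *)
have uP n : rn (u n - x) <= 2 * d 0%N - 2 * d n /\ g (u n) <= g x / 2 ^+ n.
  elim: n => [|n [ux gu]]; first by rewrite /u /= !subrr rn0 expr0 divr1.
  have ur : rn (u n - y) < r.
    have := rn_triangle (u n) x y; have := d0 n; have := d0 0%N; rewrite d00 in ux *; lra.
  have [Fu Fg] := FP _ ur.
  have FuD : rn (u n.+1 - u n) <= d n.
    apply: le_trans Fu _; rewrite /d -mulrA; exact: ler_wpM2l.
  have uS : rn (u n.+1 - x) <= 2 * d 0%N - 2 * d n.+1.
    by have := rn_triangle (u n.+1) (u n) x; have := dS n; lra.
  split=> //; have := rn_triangle (u n.+1) x y => tr.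
  apply: le_trans (Fg _) _.
    by have := d0 n.+1; have := d0 0%N; rewrite d00 in uS *; rewrite -/(u n.+1); lra.
  by rewrite exprS invfM mulrCA mulrC; apply: ler_wpM2l => //; rewrite invr_ge0.
have ur n : rn (u n - y) < r.
  have [ux _] := uP n; have := rn_triangle (u n) x y.
  by have := d0 n; have := d0 0%N; rewrite d00 in ux *; lra.
have [z zP] : exists l, forall n, rn (u n - l) <= 4 * (M * g x) / 2 ^+ n.
  apply: geometric_row => [|n]; first by rewrite mulr_ge0.
  have [Fu _] := FP _ (ur n); apply: le_trans Fu _.
  by rewrite -mulrA; apply: ler_wpM2l => //; case: (uP n).
have zx : rn (z - x) <= 4 * M * g x.
  by have := zP 0%N; rewrite expr0 divr1 mulrA rnB.
have zr : rn (z - y) < r by have := rn_triangle z x y; lra.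
exists z => //; apply/eqP; rewrite eq_le g0 andbT.
(* The Lipschitz bound compares the limit with [u n]; both the residual of [u n] and its distance to
   [z] are of order [2^-n]. *)
have gz n : g z <= (g x + `|L| * (4 * (M * g x))) / 2 ^+ n.
  have := gL _ _ zr (ur n); have [_ gu] := uP n => /le_trans; apply.
  rewrite mulrDl; apply: lerD => //; rewrite rnB -mulrA.
  apply: le_trans (_ : `|L| * rn (u n - z) <= _).
    by rewrite ler_wpM2r ?rn_ge0 ?ler_norm.
  exact: ler_wpM2l.
have lim0 : (fun n => (g x + `|L| * (4 * (M * g x))) / 2 ^+ n : R) @ \oo --> (0 : R).
  have := @cvg_geometric R (g x + `|L| * (4 * (M * g x))) (2^-1).
  rewrite /geometric /=; under eq_fun do rewrite exprVn; apply.
  by rewrite ger0_norm ?invr_ge0 // invf_lt1 // ltr1n.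
rewrite leNgt; apply/negP => gz0.
move/cvgrPdist_lt : lim0 => /(_ _ gz0)[n _ /(_ n (leqnn n))] /=.
by rewrite sub0r normrN => /(le_lt_trans (ler_norm _)); rewrite ltNge gz.
Qed.

End RealTopology.

(** * Strict differentiability of holomorphic maps *)

Section MeanValue.
Variable R : realType.
Local Notation C := (Cplx R).

Lemma rc_cvg0 : @rc R @ (0 : R)^' --> (0 : C)^'.
Proof.
move=> P; rewrite /= !near_simpl near_withinE => /near_rn[r r0 rP].
apply/dnear0_real; exists r => // t t0 tr; apply: rP; last by rewrite rc_eq0.
by rewrite subr0 rn_rc.
Qed.

Lemma real_derivative_diff N k (f : 'rV[C]_N -> 'rV[C]_k) (x v : 'rV[C]_N) :
  differentiable f x -> real_derivative_at f x v ('d f x v).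
Proof.
move=> df; rewrite /real_derivative_at -deriveE //.
have /cvg_ex[l fl] := diff_derivable (v := v) df.
have -> : 'D_v f x = l by exact: cvg_lim.
have := cvg_comp _ _ rc_cvg0 fl; rewrite /comp /=.
by under eq_fun => t do rewrite -rcV [rc t *: v + x]addrC.
Qed.

Lemma mean_value_real (g dg : R -> R) (K : R) :
  (forall s : R, 0 <= s <= 1 ->
     t^-1 * (g (s + t) - g s) @[t --> (0 : R)^'] --> dg s /\ `|dg s| <= K) ->
  `|g 1 - g 0| <= K.
Proof.
move=> gP.
have dgs (s : R) : s \in `[0, 1]%R -> is_derive s 1 g (dg s).
  rewrite in_itv /= => /gP[gs _].
  have gs' : h^-1 *: (g (h *: 1 + s) - g s) @[h --> (0 : R)^'] --> dg s.
    under eq_fun => h do rewrite [h *: 1]mulr1 [h + s]addrC.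
    exact: gs.
  by apply: DeriveDef; [apply/cvg_ex; exists (dg s)|exact: cvg_lim].
have dgo (s : R) : s \in `]0, 1[%R -> is_derive s 1 g (dg s).
  by move=> s01; apply: dgs; exact: subset_itv_oo_cc s01.
have gc : {within `[0, 1], continuous g}.
  apply: derivable_within_continuous => s s01.
  by have [] := dgs _ s01.
have [c c01 ->] := MVT_segment ler01 dgo gc.
by rewrite subr0 mulr1; move: c01; rewrite in_itv /= => /gP[].
Qed.

(** The mean value theorem holds for real-valued functions only, so it is applied to the real and
    imaginary parts of each coordinate of [f (x + s d) - s w]. The factor 2 comes from adding the
    two parts. *)
Lemma mean_value_diff N k (f : 'rV[C]_N -> 'rV[C]_k) (x d : 'rV[C]_N)
    (w : 'rV[C]_k) (K : R) :
  (forall s : R, 0 <= s <= 1 -> differentiable f (x + rc s *: d) /\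
     rn ('d f (x + rc s *: d) d - w) <= K) ->
  rn (f (x + d) - f x - w) <= 2 * K.
Proof.
move=> dfK.
have K0 : 0 <= K.
  by have [|_] := dfK 0; [rewrite lexx ler01|apply: le_trans; exact: rn_ge0].
have part (p : C -> R) : (forall a b, p (a - b) = p a - p b) ->
    (forall r a, p (rc r * a) = r * p a) -> (forall a, `|p a| <= rn a) ->
    forall i, `|p ((f (x + d) - f x - w) 0 i)| <= K.
  move=> pB pZ ple i.
  pose g (s : R) := p ((f (x + rc s *: d) - rc s *: w) 0 i).
  have -> : p ((f (x + d) - f x - w) 0 i) = g 1 - g 0.
    rewrite /g -pB [rc 0]rc0 [rc 1]rc1 !scale0r addr0 subr0 !scale1r !mxE.
    by congr (p _); ring.
  pose dg s := p (('d f (x + rc s *: d) d - w) 0 i).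
  apply: (@mean_value_real g dg) => s s01; have [df dK] := dfK s s01; split; last first.
    by apply: le_trans (ple _) _; apply: le_trans (rn_coord _ _) dK.
  have /cvg_rn q0 := real_derivative_diff (v := d) df.
  apply/subr_cvg0.
  apply/norm_cvg0P; apply: cvg0_le q0.
  rewrite near_withinE; near=> t => t0; rewrite normr_ge0 /=.
  rewrite /g /dg -pB -pZ -pB; apply: le_trans (ple _) _.
  have -> : rc (s + t) *: d = rc s *: d + rc t *: d by rewrite rcD scalerDl.
  rewrite [rc t^-1]rcV [rc (s + t)]rcD [x + (_ + _)]addrA.
  have quotient (a e D : 'rV[C]_k) (c z : C) : z != 0 ->
      z^-1 * ((a - (c + z) *: w) 0 i - (e - c *: w) 0 i) - (D - w) 0 i =
      (z^-1 *: (a - e) - D) 0 i by move=> z0; rewrite !mxE; field.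
  by rewrite quotient ?rc_eq0 //; exact: rn_coord.
apply: rn_row_le => [|i]; first by rewrite mulr_ge0.
apply: le_trans (rn_le_reim _) _.
have -> : 2 * K = K + K by ring.
apply: lerD.
  by apply: (part (@re R)) => [a b|r a|a]; [rewrite reD reN|exact: reZ|exact: rn_re].
by apply: (part (@im R)) => [a b|r a|a]; [rewrite imD imN|exact: imZ|exact: rn_im].
Unshelve. all: by end_near. Qed.

End MeanValue.

Section StrictDifferentiability.
Variable R : realType.
Local Notation C := (Cplx R).

Lemma rn_linear_le N (V : normedModType C) (T : {linear 'rV[C]_N -> V}) (M : R)
    (v : 'rV[C]_N) :
  0 <= M -> (forall i, rn (T (delta_mx 0 i)) <= M) -> rn (T v) <= N%:R * M * rn v.
Proof.
move=> M0 TM; rewrite {1}[v]row_sum_delta linear_sum.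
apply: le_trans (rn_sum _) _.
apply: le_trans (_ : \sum_(i < N) M * rn v <= _); last first.
  by rewrite sumr_const card_ord -mulrA mulr_natl.
apply: ler_sum => i _; rewrite linearZ rnZ mulrC.
by apply: ler_pM; rewrite ?rn_ge0 // rn_coord.
Qed.

(** Continuity of the differential is given for each fixed vector. On the finitely many basis
    vectors it is uniform, so ['d f z] is close to ['d f y] in operator norm near [y], and the mean
    value inequality along the segment from [x] to [x'] concludes. *)
Lemma strict_diff N k (f : 'rV[C]_N -> 'rV[C]_k) (y : 'rV[C]_N) (e : R) :
  holomorphic_near f y -> 0 < e ->
  exists2 r : R, 0 < r & forall x x', rn (x - y) < r -> rn (x' - y) < r ->
    rn (f x' - f x - 'd f y (x' - x)) <= e * rn (x' - x).
Proof.
move=> hf e0.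
have [dfy cfy] := nbhs_singleton hf.
(* The 2 absorbs the factor of [mean_value_diff], and [N.+1] the factor [N] of [rn_linear_le] while
   staying non-zero for [N = 0]. *)
pose eta : R := e / (2 * N.+1%:R).
have eta0 : 0 < eta by rewrite divr_gt0 ?mulr_gt0.
have near_d : \forall z \near y, differentiable f z /\
    forall i, rn ('d f z (delta_mx 0 i) - 'd f y (delta_mx 0 i)) <= eta.
  have h1 (i : 'I_N) : \forall z \near y,
      rn ('d f z (delta_mx 0 i) - 'd f y (delta_mx 0 i)) <= eta.
    have /cvg_rn/cvgrPdist_lt/(_ _ eta0) := cfy (delta_mx 0 i).
    by apply: filterS => z; rewrite sub0r normrN ger0_norm ?rn_ge0 //; exact: ltW.
  move/(filter_forall (nbhs_filter _)) : h1 => h1.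
  by move: hf h1; apply: filterS2 => z [].
have [r r0 rP] := (near_rn _ _).1 near_d.
exists r => // x x' xr x'r.
have -> : e * rn (x' - x) = 2 * (e / 2 * rn (x' - x)) by field.
have -> : f x' = f (x + (x' - x)) by rewrite subrKC.
apply: mean_value_diff => s /andP[s0 s1].
have /rP[dfs dle] : rn (x + rc s *: (x' - x) - y) < r.
  have -> : x + rc s *: (x' - x) - y = rc (1 - s) *: (x - y) + rc s *: (x' - y).
    by rewrite rcD rcN rc1; apply/rowP => i; rewrite !mxE; ring.
  apply: le_lt_trans (rnD _ _) _; rewrite !rnZ !rn_rc ger0_norm ?subr_ge0 // ger0_norm //.
  by have [] := leP (rn (x - y)) (rn (x' - y)); nra.
split=> //; set z := x + _.
pose T : {linear 'rV[C]_N -> 'rV[C]_k} := 'd f z \- 'd f y.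
have := @rn_linear_le N _ T eta (x' - x) (ltW eta0) dle.
rewrite /T /= => /le_trans; apply; apply: ler_wpM2r; first exact: rn_ge0.
rewrite /eta mulrA ler_pdivrMr ?mulr_gt0 // mulrC -mulrA mulrA.
have -> : e / 2 * (2 * N.+1%:R) = e * N.+1%:R by field.
by apply: ler_wpM2l; [exact: ltW|rewrite ler_nat].
Qed.

End StrictDifferentiability.

(** * The Hermitian product and real-bilinear maps *)

Section Hermitian.
Variables (R : realType) (N : nat).
Local Notation C := (Cplx R).
Local Notation V := 'rV[C]_N.
Implicit Types (u v w z : V).

Definition herm u v : C := \sum_i u 0 i * (v 0 i)^*.

Definition dot u v : R := re (herm u v).

Lemma hermDl u v w : herm (u + v) w = herm u w + herm v w.
Proof. by rewrite -big_split; apply: eq_bigr => i _; rewrite mxE mulrDl. Qed.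

Lemma hermDr u v w : herm u (v + w) = herm u v + herm u w.
Proof. by rewrite -big_split; apply: eq_bigr => i _; rewrite mxE rmorphD mulrDr. Qed.

Lemma hermZl (a : C) u v : herm (a *: u) v = a * herm u v.
Proof. by rewrite mulr_sumr; apply: eq_bigr => i _; rewrite mxE mulrA. Qed.

Lemma conj_rc (r : R) : (rc r)^* = rc r.
Proof. by apply: conj_Creal; rewrite complex_real. Qed.

Lemma hermZr (r : R) u v : herm u (rc r *: v) = rc r * herm u v.
Proof.
rewrite mulr_sumr; apply: eq_bigr => i _.
by rewrite mxE rmorphM /= conj_rc mulrCA.
Qed.

Lemma hermC u v : herm v u = (herm u v)^*.
Proof.
rewrite rmorph_sum; apply: eq_bigr => i _.
by rewrite rmorphM /= conjCK mulrC.
Qed.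

Lemma rn_herm u v : rn (herm u v) <= N%:R * rn u * rn v.
Proof.
apply: le_trans (rn_sum _) _.
apply: le_trans (_ : \sum_(i < N) rn u * rn v <= _); last first.
  by rewrite sumr_const card_ord -mulrA mulr_natl.
apply: ler_sum => i _; rewrite rnM rn_conj.
by apply: ler_pM; rewrite ?rn_ge0 // rn_coord.
Qed.

Lemma re_conj (a : C) : re a^* = re a.
Proof.
by case: a.
Qed.

Lemma dotC u v : dot u v = dot v u.
Proof. by rewrite /dot (hermC v) re_conj. Qed.

Lemma dotDl u v w : dot (u + v) w = dot u w + dot v w.
Proof. by rewrite /dot hermDl reD. Qed.

Lemma dotDr u v w : dot u (v + w) = dot u v + dot u w.
Proof. by rewrite /dot hermDr reD. Qed.

Lemma dotZl r u v : dot (rc r *: u) v = r * dot u v.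
Proof. by rewrite /dot hermZl reZ. Qed.

Lemma dotZr r u v : dot u (rc r *: v) = r * dot u v.
Proof. by rewrite dotC dotZl dotC. Qed.

Lemma dotNl u v : dot (- u) v = - dot u v.
Proof. by rewrite -scaleN1r -rc1 -rcN dotZl mulN1r. Qed.

Lemma dot_le u v : `|dot u v| <= N%:R * rn u * rn v.
Proof. exact: le_trans (rn_re _) (rn_herm _ _). Qed.

Lemma im_herm u : im (herm u u) = 0.
Proof.
have e : herm u u = \sum_i `|u 0 i| ^+ 2 by apply: eq_bigr => i _; rewrite normCK.
have : herm u u \is Num.real by rewrite e rpred_sum // => i _; rewrite rpredX // normr_real.
by move/RIm_real/eqP; rewrite -/(rc _) -[X in _ == X]rc0 => /eqP[].
Qed.

Lemma herm_dot u : herm u u = rc (dot u u).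
Proof. by rewrite [LHS]reim im_herm rc0 mulr0 addr0. Qed.

Lemma esphereE e z : esphere e z <-> dot z z = e ^+ 2.
Proof.
have e' : herm z z = \sum_i `|z 0 i| ^+ 2 by apply: eq_bigr => i _; rewrite normCK.
by rewrite /esphere /= -e' herm_dot; split=> [/complexI|->].
Qed.

End Hermitian.

Section RealBilinear.
Variable R : realType.
Local Notation C := (Cplx R).

(** Linearity is over the reals because [herm] is conjugate-linear in its second argument. *)
Definition bounded_bilinear (U V W : normedModType C) (B : U -> V -> W) :=
  [/\ forall u u' v, B (u + u') v = B u v + B u' v,
      forall u v v', B u (v + v') = B u v + B u v',
      forall (r : R) u v, B (rc r *: u) v = rc r *: B u v,
      forall (r : R) u v, B u (rc r *: v) = rc r *: B u v &
      exists M, forall u v, rn (B u v) <= M * rn u * rn v].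

Lemma rn_cvg (V : normedModType C) T (F : set_system T) {FF : Filter F}
  (f : T -> V) (a : V) : f @ F --> a -> rn (f t) @[t --> F] --> rn a.
Proof.
move=> /cvg_rn fa; apply/subr_cvg0/norm_cvg0P. refine (cvg0_le _ fa).
apply: nearW => t; rewrite normr_ge0 /=.
have := rnD (f t - a) a; rewrite subrK; have := rnD (a - f t) (f t).
by rewrite subrK rnB ler_norml; lra.
Qed.

Lemma bilinear_cvg (U V W : normedModType C) (B : U -> V -> W) T
    (F : set_system T) {FF : Filter F} (f : T -> U) (g : T -> V) a b :
  bounded_bilinear B -> f @ F --> a -> g @ F --> b ->
  B (f t) (g t) @[t --> F] --> B a b.
Proof.
move=> [BDl BDr BZl BZr [M BM]] fa gb.
have gn : rn (g t) @[t --> F] --> rn b by exact: rn_cvg.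
move/cvg_rn : gb => gb; move/cvg_rn : fa => fa.
apply/cvg_rn.
have lim : `|M| * (rn (f t - a) * rn (g t) + rn a * rn (g t - b)) @[t --> F] --> (0 : R).
  rewrite [X in _ --> X](_ : _ = `|M| * (0 * rn b + rn a * 0)); last by ring.
  exact: cvgM (cvg_cst _) (cvgD (cvgM fa gn) (cvgM (cvg_cst _) gb)).
refine (cvg0_le _ lim); apply: nearW => t; rewrite rn_ge0 /=.
have -> : B (f t) (g t) - B a b = B (f t - a) (g t) + B a (g t - b).
  have <- : B (f t - a) (g t) + B a (g t) = B (f t) (g t) by rewrite -BDl subrK.
  have <- : B a (g t - b) + B a b = B a (g t) by rewrite -BDr subrK.
  by rewrite addrA addrK.
apply: le_trans (rnD _ _) _; rewrite mulrDr; apply: lerD; apply: le_trans (BM _ _) _.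
  by rewrite -mulrA ler_wpM2r ?mulr_ge0 ?rn_ge0 ?ler_norm.
by rewrite -mulrA ler_wpM2r ?mulr_ge0 ?rn_ge0 ?ler_norm.
Qed.

(** A scalar is encoded as a row of length 1, since [Ck] and [smooth_on] speak of row-valued
    maps. *)
Definition hermr N (u v : 'rV[C]_N) : 'rV[C]_1 := const_mx (herm u v).

Lemma hermr_bilinear N : bounded_bilinear (@hermr N).
Proof.
split=> [u u' v|u v v'|r u v|r u v|].
- by apply/rowP => i; rewrite !mxE hermDl.
- by apply/rowP => i; rewrite !mxE hermDr.
- by apply/rowP => i; rewrite !mxE hermZl.
- by apply/rowP => i; rewrite !mxE hermZr.
exists N%:R => u v; apply: rn_row_le => [|i]; first by rewrite !mulr_ge0 ?rn_ge0.
by rewrite mxE rn_herm.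
Qed.

Definition scaler N (a : 'rV[C]_1) (v : 'rV[C]_N) : 'rV[C]_N := a 0 0 *: v.

Lemma scaler_bilinear N : bounded_bilinear (@scaler N).
Proof.
split=> [u u' v|u v v'|r u v|r u v|].
- by rewrite /scaler mxE scalerDl.
- by rewrite /scaler scalerDr.
- by rewrite /scaler mxE scalerA.
- by rewrite /scaler !scalerA mulrC.
by exists 1 => u v; rewrite rnZ mul1r ler_wpM2r ?rn_ge0 ?rn_coord.
Qed.

End RealBilinear.

(** * Tangent vectors of the link *)

Section Tangent.
Variables (R : realType) (N : nat).
Local Notation C := (Cplx R).
Local Notation V := 'rV[C]_N.
Implicit Types (u v w x y z : V).

Lemma velocity_continuous (c : R -> V) y v :
  rc t^-1 *: (c t - y) @[t --> (0 : R)^'] --> v -> c t @[t --> (0 : R)^'] --> y.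
Proof.
move=> cv; apply/cvg_rn.
have lim : `|t| * rn (rc t^-1 *: (c t - y)) @[t --> (0 : R)^'] --> (0 : R).
  rewrite -[X in _ --> X](mul0r (rn v)); apply: cvgM; last exact: rn_cvg.
  by apply/norm_cvg0P; exact: nbhs_dnbhs.
refine (cvg0_le _ lim); rewrite near_withinE; near=> t => t0.
rewrite rn_ge0 /= rnZ rn_rc mulrA normfV divff ?normr_eq0 // mul1r lexx //.
Unshelve. all: by end_near. Qed.

(** The difference quotient of [herm (c t) (c t)] splits exactly into the two terms of [l3]. It
    vanishes while [c] stays on the sphere, and the real part of its limit is [2 * dot v y]. *)
Lemma tangent_sphere e y v : tangent (esphere e) y v -> dot v y = 0.
Proof.
move=> [c [c0 cS cv]].
have cy := velocity_continuous cv.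
have Sy : esphere e y by rewrite -c0; exact: nbhs_singleton cS.
have l3 : hermr (rc t^-1 *: (c t - y)) (c t) + hermr y (rc t^-1 *: (c t - y))
    @[t --> (0 : R)^'] --> hermr v y + hermr y v.
  exact: cvgD (bilinear_cvg (@hermr_bilinear R N) cv cy)
    (bilinear_cvg (@hermr_bilinear R N) (cvg_cst y) cv).
have l0 : hermr (rc t^-1 *: (c t - y)) (c t) + hermr y (rc t^-1 *: (c t - y))
    @[t --> (0 : R)^'] --> (0 : 'rV[C]_1).
  apply: cvg_near_cst; apply: nbhs_dnbhs.
  apply: filterS cS => t /esphereE ct; move/esphereE : Sy => yy.
  apply/rowP => i; rewrite !mxE hermZl hermZr -mulrDr.
  suff -> : herm (c t - y) (c t) + herm y (c t - y) = 0 by rewrite mulr0.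
  have e1 : herm (c t - y) (c t) + herm y (c t) = herm (c t) (c t).
    by rewrite -hermDl subrK.
  have e2 : herm y (c t - y) + herm y y = herm y (c t) by rewrite -hermDr subrK.
  have e3 : herm (c t) (c t) = herm y y by rewrite !herm_dot ct yy.
  by apply: (addIr (herm y y)); rewrite add0r -addrA e2 e1 e3.
have : hermr v y + hermr y v = 0 by exact: cvg_unique l3 l0.
move/rowP/(_ 0); rewrite !mxE => /(congr1 (@re R)).
rewrite reD -/(dot v y) -/(dot y v) dotC => h.
have : re (0 : C) = 0 by [].
lra.
Qed.

(** The curve must be fixed before [e] is, so [c t] is taken as an almost nearest point of [Y] to
    [y + t v]. A nearest one may not exist; the slack [t ^+ 2] is itself o(t). *)
Lemma tangent_of_dist (Y : set V) y v : Y y ->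
  (forall e : R, 0 < e -> exists2 d : R, 0 < d & forall t : R, `|t| < d ->
     exists2 z, Y z & rn (z - (y + rc t *: v)) <= e * `|t|) ->
  tangent Y y v.
Proof.
move=> Yy Yv.
pose A (t : R) : set R := [set rn (z - (y + rc t *: v)) | z in Y].
have [c cP] : {c : R -> V & forall t, Y (c t) /\
    (t = 0 -> c t = y) /\ (t != 0 -> rn (c t - (y + rc t *: v)) < inf (A t) + t ^+ 2)}.
  apply: (@choice _ _ (fun (t : R) z => Y z /\ (t = 0 -> z = y) /\
    (t != 0 -> rn (z - (y + rc t *: v)) < inf (A t) + t ^+ 2))) => t.
  have [->|t0] := eqVneq t 0; first by exists y.
  have At : has_inf (A t).
    split; first by exists (rn (y - (y + rc t *: v))), y.
    by exists 0 => _ [z _ <-]; exact: rn_ge0.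
  have [|_ [z Yz <-] zlt] := @inf_adherent R (A t) (t ^+ 2) _ At.
    by rewrite exprn_even_gt0.
  by exists z; split=> //; split=> // t00; rewrite t00 eqxx in t0.
exists c; split; first by case: (cP 0) => _ [-> //].
  by apply: (@filterE _ (nbhs (0 : R))) => t; case: (cP t).
apply/cvg_rn/cvgrPdist_lt => e e0.
have e20 : 0 < e / 2 by rewrite divr_gt0.
have [d d0 dP] := Yv _ e20.
apply/dnear0_real; exists (Num.min d (e / 2)); first by rewrite lt_min d0.
move=> t t0; rewrite lt_min => /andP[td te].
rewrite sub0r normrN ger0_norm ?rn_ge0 //.
have -> : rc t^-1 *: (c t - y) - v = rc t^-1 *: (c t - (y + rc t *: v)).
  rewrite opprD addrA [in RHS]scalerBr scalerA -rcM mulVf // rc1 scale1r //.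
have [_ [_ /(_ t0) ct]] := cP t.
have [z Yz zt] := dP t td.
have infz : inf (A t) <= e / 2 * `|t|.
  apply: le_trans zt; apply: ge_inf; last by exists z.
  by exists 0 => _ [z' _ <-]; exact: rn_ge0.
rewrite rnZ rn_rc normfV mulrC ltr_pdivrMr ?normr_gt0 //.
have : t ^+ 2 = `|t| * `|t| by rewrite -expr2 real_normK // num_real.
have : 0 < `|t| by rewrite normr_gt0.
by nra.
Qed.

End Tangent.

(** * Lyusternik's theorem for the equations of the link *)

Section Link.
Variables (R : realType) (N k : nat).
Local Notation C := (Cplx R).
Local Notation V := 'rV[C]_N.
Implicit Types (u v x y z : V).

Lemma linear_bounded (T : {linear V -> 'rV[C]_k}) :
  exists2 K : R, 0 <= K & forall v, rn (T v) <= K * rn v.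
Proof.
pose M : R := \sum_i rn (T (delta_mx 0 i)).
have M0 : 0 <= M by apply: sumr_ge0 => i _; exact: rn_ge0.
exists (N%:R * M) => [|v]; first by rewrite mulr_ge0.
apply: rn_linear_le => // i.
by rewrite /M (bigD1 i) //= lerDl sumr_ge0 // => j _; exact: rn_ge0.
Qed.

Lemma right_inverse_bounded (T : {linear V -> 'rV[C]_k}) :
  (forall w, exists v, T v = w) ->
  exists2 M : R, 0 <= M & forall w, exists2 v, T v = w & rn v <= M * rn w.
Proof.
move=> Tsurj.
have [d dP] := choice (fun i : 'I_k => Tsurj (delta_mx 0 i)).
exists (\sum_i rn (d i)) => [|w]; first by apply: sumr_ge0 => i _; exact: rn_ge0.
exists (\sum_i w 0 i *: d i).
  by rewrite linear_sum [RHS]row_sum_delta; apply: eq_bigr => i _; rewrite linearZ /= dP.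
apply: le_trans (rn_sum _) _; rewrite mulr_suml; apply: ler_sum => i _.
by rewrite rnZ mulrC ler_wpM2l ?rn_ge0 ?rn_coord.
Qed.

Variables (S : set V) (f : V -> 'rV[C]_k) (y : V).
Hypotheses (hf : holomorphic_near f y) (Sf : \forall z \near y, S z <-> f z = 0).
Hypothesis Sy : S y.

Lemma fy0 : f y = 0.
Proof. by apply/(nbhs_singleton Sf). Qed.

(** Since [f] vanishes at [c t] and at [y], strict differentiability bounds ['d f y q] by [e * rn q]
    for the difference quotient [q], which lies within [e] of [v]. *)
Lemma tangent_ker v : tangent S y v -> 'd f y v = 0.
Proof.
move=> [c [c0 cS cv]]; apply: rn_eq0; apply/eqP; rewrite eq_le rn_ge0 andbT.
have [K K0 TK] := linear_bounded ('d f y).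
have cy := velocity_continuous cv.
have D0 : 0 < rn v + 1 + K by have := rn_ge0 v; lra.
(* [e * rn q] contributes [e * (rn v + 1)], because [e <= 1]; replacing [v] by [q] contributes
   [K * e]. *)
suff step (e : R) : 0 < e <= 1 -> rn ('d f y v) <= e * (rn v + 1 + K).
  rewrite leNgt; apply/negP => dv0.
  pose e : R := Num.min 1 (rn ('d f y v) / (2 * (rn v + 1 + K))).
  have e0 : 0 < e by rewrite lt_min ltr01 divr_gt0 // mulr_gt0.
  have e1 : e <= 1 by rewrite ge_min lexx.
  have : e <= rn ('d f y v) / (2 * (rn v + 1 + K)) by rewrite ge_min lexx orbT.
  rewrite ler_pdivlMr ?mulr_gt0 // => eD.
  have := step e; rewrite e0 e1 => /(_ isT); lra.
move=> /andP[e0 e1].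
have [r r0 rP] := strict_diff hf e0.
have near1 : \forall t \near (0 : R)^', rn (rc t^-1 *: (c t - y) - v) < e.
  have /cvg_rn/cvgrPdist_lt/(_ _ e0) := cv; apply: filterS => t.
  by rewrite sub0r normrN ger0_norm ?rn_ge0.
have near2 : \forall t \near (0 : R)^', rn (c t - y) < r /\ f (c t) = 0.
  have near3 : \forall z \near y, rn (z - y) < r /\ (S z <-> f z = 0).
    by apply: filterS2 Sf ((near_rn _ _).2 (ex_intro2 _ _ r r0 (fun z h => h))).
  have := cy _ near3; move: (nbhs_dnbhs cS); apply: filterS2 => t Sct [ct Sft].
  by split=> //; apply/Sft.
have [t [q1 [ctr ft]]] := @filter_ex _ (0 : R)^' _ _ (filterI near1 near2).
set q := rc t^-1 *: (c t - y) in q1.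
have dq : rn ('d f y q) <= e * rn q.
  have := rP y (c t); rewrite subrr rn0 => /(_ r0 ctr).
  rewrite ft fy0 subrr sub0r rnN => h.
  by rewrite /q linearZ /= !rnZ mulrCA ler_wpM2l ?rn_ge0.
have -> : 'd f y v = 'd f y q - 'd f y (q - v) by rewrite -linearB /= subKr.
apply: le_trans (rnD _ _) _; rewrite rnN.
have := TK (q - v); have := rnD (q - v) v; rewrite subrK.
have := rn_ge0 q; have := rn_ge0 v; have := rn_ge0 (q - v).
by nra.
Qed.

Hypothesis dfsurj : forall w, exists v, 'd f y v = w.
Variables (e : R) (u : V).
Hypotheses (ye : esphere e y) (du : 'd f y u = 0) (uy : dot u y != 0).

Let g x : R := rn (f x) + `|dot x x - e ^+ 2|.

(** The correction is [d = d1 + sg u]: [d1] solves the linearised equation for [f], and [sg] is then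
    chosen to solve the linearised sphere equation, [u] being in the kernel of ['d f y] with
    [dot u y != 0]. Each of the two residuals drops to a quarter of [g x]. *)
Lemma newton_step : exists2 M : R, 0 <= M & exists2 r : R, 0 < r &
  forall x, rn (x - y) < r -> exists2 x', rn (x' - x) <= M * g x &
     rn (x' - y) < r -> g x' <= g x / 2.
Proof.
have [M1 M10 TM1] := right_inverse_bounded dfsurj.
pose ka := dot u y; have ka0 : ka != 0 by [].
(* [A] bounds [dot d1 y] in terms of [rn (f x)], and [B] converts the sphere defect left by [d1]
   into the length of [sg u]; [M] adds up the lengths of the two parts of [d]. *)
pose A : R := N%:R * rn y * M1.
pose B : R := rn u / (2 * `|ka|).
have A0 : 0 <= A by rewrite !mulr_ge0 ?rn_ge0.
have B0 : 0 <= B by rewrite divr_ge0 ?rn_ge0 ?mulr_ge0.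
pose M : R := M1 + (1 + 2 * A) * B.
have M0 : 0 <= M by rewrite addr_ge0 // mulr_ge0 // addr_ge0 // mulr_ge0.
(* [eta] and [r2] are tuned so that the errors in [f] and in the sphere equation are at most
   [g x / 4]; the added ones keep the denominators positive. *)
pose eta : R := (4 * (M + 1))^-1.
have eta0 : 0 < eta by rewrite invr_gt0; lra.
have etaM : eta * M <= 4^-1.
  by rewrite /eta mulrC ler_pdivrMr; lra.
have [r1 r10 r1P] := strict_diff hf eta0.
pose r2 : R := (8 * (N.+1%:R * (M + 1)))^-1.
have r20 : 0 < r2 by rewrite invr_gt0 !mulr_gt0 //; lra.
have r2M : 2 * N%:R * r2 * M <= 4^-1.
  rewrite /r2 mulrAC ler_pdivrMr; last by rewrite !mulr_gt0 //; lra.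
  rewrite -natr1; have : 0 <= N%:R :> R by []; nra.
exists M => //; exists (Num.min r1 r2); first by rewrite lt_min r10.
move=> x; rewrite lt_min => /andP[xr1 xr2].
have [d1 fd1 d1le] := TM1 (- f x); rewrite rnN in d1le.
pose rho : R := dot x x - e ^+ 2.
pose sg : R := - (rho + 2 * dot d1 y) / (2 * ka).
pose d : V := d1 + rc sg *: u.
have dfd : 'd f y d = - f x by rewrite /d linearD linearZ /= du scaler0 addr0.
have doty : 2 * dot d y = - rho.
  by rewrite /d dotDl dotZl -/ka /sg; field.
have gE : g x = rn (f x) + `|rho| by [].
have sgle : `|sg| * rn u <= (1 + 2 * A) * B * g x.
  have -> : `|sg| * rn u = `|rho + 2 * dot d1 y| * B.
    rewrite /sg /B normrM normrN normfV normrM ger0_norm // -!mulrA.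
    by congr (_ * _); rewrite mulrC.
  rewrite [leRHS]mulrAC; apply: ler_wpM2r => //.
  apply: le_trans (ler_normD _ _) _; rewrite normrM ger0_norm //.
  have : `|dot d1 y| <= A * rn (f x).
    apply: le_trans (dot_le _ _) _; rewrite /A mulrAC -[leRHS]mulrA.
    by apply: ler_wpM2l; rewrite // mulr_ge0 ?rn_ge0.
  have := normr_ge0 rho; have := rn_ge0 (f x); rewrite gE; nra.
have dM : rn d <= M * g x.
  apply: le_trans (rnD _ _) _; rewrite rnZ rn_rc /M mulrDl; apply: lerD => //.
  apply: le_trans d1le _; apply: ler_wpM2l => //.
  by rewrite gE lerDl.
clearbody d; exists (x + d); first by rewrite addrAC subrr add0r.
rewrite lt_min => /andP[x'r1 x'r2].
have f' : rn (f (x + d)) <= 4^-1 * g x.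
  have := r1P x (x + d) xr1 x'r1; rewrite [x + d - x]addrAC subrr add0r dfd opprK subrK => h.
  apply: le_trans h _; apply: le_trans (_ : eta * (M * g x) <= _).
    by apply: ler_wpM2l => //; exact: ltW.
  by rewrite mulrA ler_wpM2r // addr_ge0 ?rn_ge0.
have rho' : `|dot (x + d) (x + d) - e ^+ 2| <= 4^-1 * g x.
  (* By [doty] the part linearised at [y] cancels [rho]. The remainder is small because [x] and
     [x + d] are both near [y]. *)
  have -> : dot (x + d) (x + d) - e ^+ 2 = dot d (x - y) + dot d (x + d - y).
    have NyE w : dot w (- y) = - dot w y by rewrite dotC dotNl dotC.
    rewrite !dotDl !dotDr !NyE; rewrite [dot x d]dotC.
    by have : rho = dot x x - e ^+ 2 by []; lra.
  apply: le_trans (ler_normD _ _) _.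
  have h1 := dot_le d (x - y); have h2 := dot_le d (x + d - y).
  have h3 : N%:R * rn d * rn (x - y) <= N%:R * rn d * r2.
    by apply: ler_wpM2l; [rewrite mulr_ge0 ?rn_ge0|exact: ltW].
  have h4 : N%:R * rn d * rn (x + d - y) <= N%:R * rn d * r2.
    by apply: ler_wpM2l; [rewrite mulr_ge0 ?rn_ge0|exact: ltW].
  apply: le_trans (_ : 2 * N%:R * r2 * rn d <= _); first by lra.
  apply: le_trans (_ : 2 * N%:R * r2 * (M * g x) <= _).
    by apply: ler_wpM2l => //; rewrite !mulr_ge0 // ltW.
  by rewrite mulrA ler_wpM2r // addr_ge0 ?rn_ge0.
by rewrite /g; have := gE; rewrite /g; lra.
Qed.

Lemma residual_lipschitz : exists L : R, exists2 r : R, 0 < r & forall x x',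
  rn (x - y) < r -> rn (x' - y) < r -> g x <= g x' + L * rn (x - x').
Proof.
have [K K0 TK] := linear_bounded ('d f y).
have [r r0 rP] := strict_diff hf (@ltr01 R).
exists (1 + K + N%:R * (2 * rn y + 2 * r)), r => // x x' xr x'r.
have h1 : rn (f x) <= rn (f x') + (1 + K) * rn (x - x').
  have := rP _ _ x'r xr; have := TK (x - x').
  have := rnD (f x - f x' - 'd f y (x - x')) ('d f y (x - x')).
  by have := rnD (f x - f x') (f x'); rewrite !subrK; lra.
have h2 : `|dot x x - e ^+ 2| <= `|dot x' x' - e ^+ 2| +
    N%:R * (2 * rn y + 2 * r) * rn (x - x').
  have -> : dot x x - e ^+ 2 = dot x' x' - e ^+ 2 + dot (x - x') (x + x').
    by rewrite dotDl dotNl !dotDr [dot x' x]dotC; ring.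
  apply: le_trans (ler_normD _ _) _; rewrite lerD2l.
  apply: le_trans (dot_le _ _) _; rewrite mulrAC; apply: ler_wpM2r; first exact: rn_ge0.
  apply: ler_wpM2l => //.
  have := rnD (x - y) y; have := rnD (x' - y) y; have := rnD x x'.
  by rewrite !subrK; lra.
by rewrite /g; lra.
Qed.

(** Both first-order terms vanish, so the residual of [y + t v] is o(t): the sphere part is exactly
    [t ^+ 2 * dot v v], and strict differentiability bounds the other. [zero_near] then finds a
    point of the link at distance o(t). *)
Lemma tangent_link v : 'd f y v = 0 -> dot v y = 0 ->
  tangent (S `&` esphere e) y v.
Proof.
move=> dv vy; apply: tangent_of_dist => // eps eps0.
have [M M0 [r1 r10 r1P]] := newton_step.
have [L [r2 r20 r2P]] := residual_lipschitz.
have [r3 r30 r3P] := (near_rn _ _).1 Sf.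
pose r := Num.min r1 (Num.min r2 r3).
have r0 : 0 < r by rewrite !lt_min r10 r20.
have rr1 : r <= r1 by rewrite ge_min lexx.
have rr2 : r <= r2 by rewrite !ge_min lexx orbT.
have rr3 : r <= r3 by rewrite !ge_min lexx !orbT.
have yy := (esphereE _ _).1 ye.
(* The residual of [y + t v] will be at most [2 * E * |t|], and [zero_near] moves by at most [4 * M]
   times that. *)
pose E : R := eps / (8 * (M + 1)).
have E0 : 0 < E by rewrite divr_gt0 // mulr_gt0 //; lra.
have EM : 4 * M * (2 * E) <= eps.
  have -> : eps = E * (8 * (M + 1)) by rewrite /E divfK // gt_eqF // mulr_gt0 //; lra.
  by nra.
pose n := rn v; have n0 : 0 <= n := rn_ge0 v.
have en0 : 0 < E / (n + 1) by rewrite divr_gt0 //; lra.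
have [r4 r40 r4P] := strict_diff hf en0.
(* The three bounds keep [y + t v] in the ball of strict differentiability, leave room in the ball
   of radius [r] for the whole Newton iteration, and make the quadratic sphere term at most
   [E * |t|]. *)
pose D : R := Num.min (r4 / (n + 1))
  (Num.min (r / (2 * (n + 1 + eps))) (E / (`|dot v v| + 1))).
have vv0 : 0 <= `|dot v v| by [].
exists D; first by rewrite !lt_min !divr_gt0 //; lra.
move=> t; rewrite !lt_min => /andP[t4 /andP[tr tv]].
rewrite ltr_pdivlMr in t4; last by lra.
rewrite ltr_pdivlMr in tr; last by lra.
rewrite ltr_pdivlMr in tv; last by lra.
have t0 : 0 <= `|t| by [].
set x := y + rc t *: v.
have xy : x - y = rc t *: v by rewrite /x addrAC subrr add0r.
have xyn : rn (x - y) = `|t| * n by rewrite xy rnZ rn_rc.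
have fx : rn (f x) <= E * `|t|.
  have := r4P y x; rewrite subrr rn0 => /(_ r40).
  have xr4 : rn (x - y) < r4 by rewrite xyn; lra.
  move=> /(_ xr4); rewrite xyn xy linearZ /= dv scaler0 subr0 fy0 subr0.
  move=> /le_trans; apply; rewrite -mulrA ler_wpM2l //; first exact: ltW.
  rewrite mulrCA ler_piMr // mulrC ler_pdivrMr; lra.
have rhox : `|dot x x - e ^+ 2| <= E * `|t|.
  rewrite -yy /x dotDl !dotDr !dotZl !dotZr [dot y v]dotC vy !mulr0 addr0 add0r.
  rewrite addrAC subrr add0r mulrA !normrM -mulrA mulrC.
  by apply: ler_wpM2r => //; lra.
have gx : g x <= 2 * E * `|t| by rewrite /g; lra.
have g0 : 0 <= g x by rewrite addr_ge0 ?rn_ge0.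
have Mgx : 4 * M * g x <= eps * `|t|.
  apply: le_trans (_ : 4 * M * (2 * E * `|t|) <= _).
    by apply: ler_wpM2l => //; rewrite mulr_ge0.
  by rewrite mulrA; apply: ler_wpM2r.
have [||||z gz zx] := @zero_near R N g y r M L M0 _ _ _ x.
- by move=> x1; rewrite addr_ge0 ?rn_ge0.
- by move=> x1 x2 x1r x2r; apply: r2P; [exact: lt_le_trans rr2|exact: lt_le_trans rr2].
- move=> x1 x1r; have [x' h1 h2] := r1P x1 (lt_le_trans x1r rr1).
  by exists x' => // x'r; apply: h2; exact: lt_le_trans rr1.
- rewrite xyn; nra.
exists z; last exact: le_trans zx Mgx.
have zr : rn (z - y) < r.
  have := rnD (z - x) (x - y); rewrite addrA subrK xyn; nra.
have fz0 : rn (f z) = 0.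
  by have := rn_ge0 (f z); have := normr_ge0 (dot z z - e ^+ 2); rewrite /g in gz; lra.
have rz0 : `|dot z z - e ^+ 2| = 0 by rewrite /g fz0 add0r in gz.
split.
  by apply/(r3P z (lt_le_trans zr rr3)); exact: rn_eq0.
by apply/esphereE/eqP; rewrite -subr_eq0 -normr_eq0 rz0.
Qed.

End Link.

(** * Smooth maps *)

Section Smooth.
Variables (R : realType) (N : nat).
Local Notation C := (Cplx R).
Local Notation V := 'rV[C]_N.
Implicit Types (x v : V) (U B : set V).

Lemma real_derivative_bilinear j k l (b : 'rV[C]_j -> 'rV[C]_k -> 'rV[C]_l)
    (f : V -> 'rV[C]_j) (g : V -> 'rV[C]_k) x v df dg :
  bounded_bilinear b -> real_derivative_at f x v df -> real_derivative_at g x v dg ->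
  real_derivative_at (fun x => b (f x) (g x)) x v (b df (g x) + b (f x) dg).
Proof.
move=> bb fdf gdg.
have gc : g (x + rc t *: v) @[t --> (0 : R)^'] --> g x.
  apply: cvg_trans (velocity_continuous gdg).
  by apply: near_eq_cvg; near=> t.
rewrite /real_derivative_at.
have [bDl bDr bZl bZr _] := bb.
have product_rule t : b (rc t^-1 *: (f (x + rc t *: v) - f x)) (g (x + rc t *: v)) +
    b (f x) (rc t^-1 *: (g (x + rc t *: v) - g x)) =
    rc t^-1 *: (b (f (x + rc t *: v)) (g (x + rc t *: v)) - b (f x) (g x)).
  rewrite bZl bZr -scalerDr; congr (_ *: _).
  set f' := f (_ + _); set g' := g (_ + _).
  have -> : b f' g' = b (f' - f x) g' + b (f x) g' by rewrite -bDl subrK.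
  have -> : b (f x) g' = b (f x) (g' - g x) + b (f x) (g x) by rewrite -bDr subrK.
  by rewrite addrA addrK.
apply: cvg_trans (cvgD (bilinear_cvg bb fdf gc) (bilinear_cvg bb (cvg_cst (f x)) gdg)).
by apply: near_eq_cvg; near=> t; exact: product_rule.
Unshelve. all: by end_near. Qed.

Lemma real_derivativeD k (f g : V -> 'rV[C]_k) x v df dg :
  real_derivative_at f x v df -> real_derivative_at g x v dg ->
  real_derivative_at (fun x => f x + g x) x v (df + dg).
Proof.
move=> fdf gdg.
have sum_rule (t : R) : rc t^-1 *: (f (x + rc t *: v) - f x) +
    rc t^-1 *: (g (x + rc t *: v) - g x) =
    rc t^-1 *: (f (x + rc t *: v) + g (x + rc t *: v) - (f x + g x)).
  by rewrite -scalerDr; congr (_ *: _); rewrite opprD addrACA.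
apply: cvg_trans (cvgD fdf gdg).
by apply: near_eq_cvg; near=> t; exact: sum_rule.
Unshelve. all: by end_near. Qed.

Lemma CkS k n U (f : V -> 'rV[C]_k) : Ck n.+1 U f -> Ck n U f.
Proof.
elim: n f => [|n IH] f [fc fd]; first by [].
split=> // v; have [g fg /IH Ckg] := fd v.
by exists g.
Qed.

Lemma Ck_subset k n U U' (f : V -> 'rV[C]_k) : U' `<=` U -> Ck n U f -> Ck n U' f.
Proof.
move=> UU; elim: n f => [|n IH] f [fc fd].
  by split=> // x /UU; exact: fc.
split=> [x /UU|v]; first exact: fc.
by have [g fg /IH Ckg] := fd v; exists g => // x /UU; exact: fg.
Qed.

Lemma CkD k n U (f g : V -> 'rV[C]_k) :
  Ck n U f -> Ck n U g -> Ck n U (fun x => f x + g x).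
Proof.
elim: n f g => [|n IH] f g [fc fd] [gc gd].
  split; last by [].
  by move=> x Ux; have fx := fc x Ux; have gx := gc x Ux; exact: (cvgD fx gx).
split=> [x Ux|v].
  by have fx := fc x Ux; have gx := gc x Ux; exact: (cvgD fx gx).
have [f' ff' Ckf'] := fd v; have [g' gg' Ckg'] := gd v.
exists (fun x => f' x + g' x); last exact: IH.
by move=> x Ux; apply: real_derivativeD; [exact: ff'|exact: gg'].
Qed.

(** The induction must vary [f] and [g]: the derivative is a sum of two products, each pairing a
    derivative of order [n] with an underived factor lowered to order [n] by [CkS]. *)
Lemma Ck_bilinear j k l (b : 'rV[C]_j -> 'rV[C]_k -> 'rV[C]_l) n U
    (f : V -> 'rV[C]_j) (g : V -> 'rV[C]_k) :
  bounded_bilinear b -> Ck n U f -> Ck n U g -> Ck n U (fun x => b (f x) (g x)).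
Proof.
move=> bb; elim: n f g => [|n IH] f g.
  move=> [fc _] [gc _]; split=> // x Ux.
  exact: bilinear_cvg bb (fc x Ux) (gc x Ux).
move=> Cf Cg; have [fc fd] := Cf; have [gc gd] := Cg.
split=> [x Ux|v].
  exact: bilinear_cvg bb (fc x Ux) (gc x Ux).
have [f' ff' Ckf'] := fd v; have [g' gg' Ckg'] := gd v.
exists (fun x => b (f' x) (g x) + b (f x) (g' x)).
  by move=> x Ux; apply: real_derivative_bilinear; [|exact: ff'|exact: gg'].
by apply: CkD; apply: IH => //; exact: CkS.
Qed.

Lemma Ck_cst k n U (a : 'rV[C]_k) : Ck n U (fun _ : V => a).
Proof.
elim: n a => [|n IH] a; split; [by move=> x _; exact: cst_continuous|by []| |].
  by move=> x _; exact: cst_continuous.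
move=> v; exists (fun=> 0) => // x _; rewrite /real_derivative_at.
by under eq_fun do rewrite subrr scaler0; exact: cvg_cst.
Qed.

Lemma Ck_id n U : Ck n U (fun x : V => x).
Proof.
case: n => [|n]; first by split=> // x _; exact: cvg_id.
split=> [x _|v]; first exact: cvg_id.
exists (fun=> v); last exact: Ck_cst.
move=> x _; apply: cvg_near_cst; rewrite near_withinE; near=> t => t0.
by rewrite addrAC subrr add0r scalerA -rcM mulVf // rc1 scale1r.
Unshelve. all: by end_near. Qed.

Lemma smooth_on_subset k B B' (f : V -> 'rV[C]_k) :
  B' `<=` B -> smooth_on B f -> smooth_on B' f.
Proof.
move=> BB fs x /[dup] B'x /BB/fs[U [g [oU Ux Ckg fg]]]; exists U, g; split=> //.
by move=> y /BB; exact: fg.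
Qed.

Lemma smooth_on_combine j k l B (b : 'rV[C]_j -> 'rV[C]_k -> 'rV[C]_l)
    (f : V -> 'rV[C]_j) (g : V -> 'rV[C]_k) :
  (forall n U f g, Ck n U f -> Ck n U g -> Ck n U (fun x : V => b (f x) (g x))) ->
  smooth_on B f -> smooth_on B g -> smooth_on B (fun x => b (f x) (g x)).
Proof.
move=> bC fs gs x Bx.
have [U [f' [oU Ux Cf ff']]] := fs x Bx; have [W [g' [oW Wx Cg gg']]] := gs x Bx.
exists (U `&` W), (fun x => b (f' x) (g' x)); split.
- exact: openI.
- by [].
- move=> n; apply: bC; first by apply: Ck_subset (Cf n) => z [].
  by apply: Ck_subset (Cg n) => z [].
by move=> y By [Uy Wy]; rewrite ff' // gg'.
Qed.

Lemma smooth_on_bilinear j k l B (b : 'rV[C]_j -> 'rV[C]_k -> 'rV[C]_l)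
    (f : V -> 'rV[C]_j) (g : V -> 'rV[C]_k) :
  bounded_bilinear b ->
  smooth_on B f -> smooth_on B g -> smooth_on B (fun x => b (f x) (g x)).
Proof. by move=> bb; apply: smooth_on_combine => *; exact: Ck_bilinear. Qed.

Lemma smooth_onD k B (f g : V -> 'rV[C]_k) :
  smooth_on B f -> smooth_on B g -> smooth_on B (fun x => f x + g x).
Proof. by apply: smooth_on_combine => *; exact: CkD. Qed.

Lemma smooth_on_cst k B (a : 'rV[C]_k) : smooth_on B (fun _ : V => a).
Proof.
move=> x Bx; exists setT, (fun=> a); split=> // [|n]; first exact: openT.
exact: Ck_cst.
Qed.

Lemma smooth_on_id B : smooth_on B (fun x : V => x).
Proof.
move=> x Bx; exists setT, id; split=> // [|n]; first exact: openT.
exact: Ck_id.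
Qed.

End Smooth.

(** * The contact planes *)

Section Frame.
Variables (R : realType) (N : nat).
Local Notation C := (Cplx R).
Local Notation V := 'rV[C]_N.
Implicit Types (u v x y z : V) (S : set V).

Lemma tangent_subset S S' y v : S `<=` S' -> tangent S y v -> tangent S' y v.
Proof.
by move=> SS [c [c0 cS cv]]; exists c; split=> //; apply: filterS cS => t /SS.
Qed.

Lemma tangent_linkP S d e y v : submanifold_at S d y -> esphere e y ->
  (exists2 u, tangent S y u & dot u y != 0) ->
  tangent (S `&` esphere e) y v <-> tangent S y v /\ dot v y = 0.
Proof.
move=> [k [f [_ hf Sf Sy fsurj]]] ye [u Su uy]; split=> [Yv|[Sv vy]].
  split; first by apply: tangent_subset Yv => z [].
  by apply: (@tangent_sphere _ _ e); apply: tangent_subset Yv => z [].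
by apply: (tangent_link hf Sf Sy fsurj ye (tangent_ker hf Sf Sy Su) uy) => //;
  exact: tangent_ker hf Sf Sy _ Sv.
Qed.

(** Transversality is applied to the radial vector [y] itself: its component tangent to the sphere
    is orthogonal to [y], so the component in [TS] has product [e ^+ 2] with [y]. *)
Lemma transverse_sphere S e y : e != 0 -> esphere e y ->
  transverse_at S (esphere e) y -> exists2 u, tangent S y u & dot u y != 0.
Proof.
move=> e0 ye tr; have [u [v [Su Ev yuv]]] := tr y; exists u => //.
have : dot y y = dot u y by rewrite {1}yuv dotDl (tangent_sphere Ev) addr0.
by rewrite ((esphereE _ _).1 ye) => <-; rewrite expf_neq0.
Qed.

(** [rn] is the maximum of the moduli of the coordinates, hence at most the Euclidean norm. *)
Lemma rn_esphere e y : 0 <= e -> esphere e y -> rn y <= e.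
Proof.
move=> e0 ye; apply: rn_row_le => // i.
have : rc (rn (y 0 i) ^+ 2) <= rc (e ^+ 2).
  rewrite -ye (bigD1 i) //= normE expr2 rcM -expr2 lerDl.
  by apply: sumr_ge0 => j _; rewrite exprn_ge0.
by rewrite rc_le ler_pXn2r // nnegrE rn_ge0.
Qed.

(** In the coordinates of the frame, [herm _ y] is the linear form with coefficients [a] and [b].
    The vector [u] makes it non-zero, so its kernel is the line through [(b, - a)]; the coefficient
    [g] is found by dividing by whichever of [a], [b] is non-zero. *)
Lemma hyperplane_frame (T : set V) y s0 s1 :
  let w := herm s1 y *: s0 - herm s0 y *: s1 in
  (forall a b : C, T (a *: s0 + b *: s1)) ->
  (forall v, T v -> exists a b : C, v = a *: s0 + b *: s1) ->
  (forall a b : C, a *: s0 + b *: s1 = 0 -> a = 0 /\ b = 0) ->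
  (exists2 u, T u & herm u y != 0) ->
  w != 0 /\ forall v, T v /\ herm v y = 0 <-> exists g : C, v = g *: w.
Proof.
move=> w Tlin Tspan Tfree [u Tu uy].
set a := herm s0 y in w *; set b := herm s1 y in w *.
have wE : w = b *: s0 + (- a) *: s1 by rewrite /w scaleNr.
have abN0 : ~ (a = 0 /\ b = 0).
  move=> [a0 b0]; have [al [be ue]] := Tspan u Tu.
  by move: uy; rewrite ue hermDl !hermZl -/a -/b a0 b0 !mulr0 addr0 eqxx.
split.
  apply/eqP; rewrite wE => /Tfree[b0 /eqP]; rewrite oppr_eq0 => /eqP a0.
  exact: abN0.
move=> v; split=> [[Tv vy]|[g ->]]; last first.
  rewrite wE; split; first by rewrite scalerDr !scalerA; exact: Tlin.
  by rewrite hermZl hermDl !hermZl -/a -/b; ring.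
have [al [be ve]] := Tspan v Tv.
have ab0 : al * a + be * b = 0 by rewrite -vy ve hermDl !hermZl.
have [b0|b0] := eqVneq b 0.
  have a0 : a != 0 by apply/eqP => a0; exact: abN0.
  have al0 : al = 0.
    by move: ab0; rewrite b0 mulr0 addr0 => /eqP; rewrite mulf_eq0 (negPf a0) orbF => /eqP.
  exists (- be / a); rewrite ve wE al0 b0 !scale0r !add0r scalerA; congr (_ *: _).
  by field.
exists (al / b); rewrite ve wE scalerDr !scalerA divfK //; congr (_ + _ *: _).
apply: (mulIf b0); rewrite -[LHS](addrK (al * a)) [be * b + _]addrC ab0.
by field.
Qed.

End Frame.

(** * The global frame of the contact structure *)

Lemma row2 (K : Type) (a b : K) : exists c : 'rV[K]_2, c 0 0 = a /\ c 0 1 = b.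
Proof. by exists (\row_i if i == 0 then a else b); rewrite !mxE. Qed.

Theorem proposition1 (R : realType) (N : nat) (S : set 'rV[Cplx R]_N) :
  isolated_surface_singularity S ->
  numerically_gorenstein S ->
  \forall e \near (0 : R)^'+, forall Y : set 'rV[Cplx R]_N,
    is_link S e Y -> trivial_real_bundle 2 Y (xi_can Y).
Proof.
move=> [_ _ _ Ssub] [W [oW W0] [s [ssm sP]]].
have nearW : \forall x \near (0 : 'rV[Cplx R]_N),
    W x /\ (x != 0 -> S x -> submanifold_at S 2 x).
  move: Ssub; rewrite near_withinE => Ssub.
  by apply: filterS2 (open_nbhs_nbhs (conj oW W0)) Ssub.
(* [r] is the threshold for [e]: away from the origin, the part of [S] in this ball is smooth and
   lies in the domain of the given frame. *)
have [r r0 rP] := (near_rn _ _).1 nearW.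
near=> e => Y [YE Ytr].
have e0 : 0 < e by near: e; exact: nbhs_right_gt.
have er : e < r by near: e; exact: nbhs_right_lt.
have YB y : Y y -> [/\ S y, esphere e y, (S `&` W `\ 0) y & submanifold_at S 2 y].
  rewrite YE => -[Sy ye].
  have [Wy subm] : W y /\ (y != 0 -> S y -> submanifold_at S 2 y).
    by apply: rP; rewrite subr0; apply: le_lt_trans er; exact: rn_esphere (ltW e0) ye.
  have y0 : y != 0.
    apply/eqP => y0; have := (esphereE _ _).1 ye.
    have -> : dot y y = 0 by rewrite y0 /dot /herm big1 // => i _; rewrite mxE mul0r.
    by move/esym/eqP; rewrite expf_eq0 /= gt_eqF.
  by split=> //; [split=> //; apply/eqP|exact: subm].
(* Written with row-valued products so that the smoothness lemmas apply; [wE] recovers the plain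
   formula. *)
pose w y := scaler (hermr (s 1 y) y) (s 0 y) +
  scaler (const_mx (- 1)) (scaler (hermr (s 0 y) y) (s 1 y)).
pose frame (i : 'I_2) y := if i == 0 then w y else scaler (const_mx 'i) (w y).
have wE y : w y = herm (s 1 y) y *: s 0 y - herm (s 0 y) y *: s 1 y.
  by rewrite /w /scaler !mxE scaleN1r.
have wsm : smooth_on Y w.
  have ss i : smooth_on Y (s i) by apply: smooth_on_subset (ssm i) => y /YB[].
  have hs i : smooth_on Y (fun y => hermr (s i y) y).
    by apply: (smooth_on_bilinear (@hermr_bilinear R N)); [exact: ss|exact: smooth_on_id].
  apply: smooth_onD; apply: (smooth_on_bilinear (@scaler_bilinear R N)) => //.
    exact: smooth_on_cst.
  exact: (smooth_on_bilinear (@scaler_bilinear R N)).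
exists frame; split=> [i|y Yy].
  rewrite /frame; case: (i == 0) => //.
  by apply: (smooth_on_bilinear (@scaler_bilinear R N)); [exact: smooth_on_cst|].
have [Sy ye By subm] := YB y Yy.
have [Alin Aspan] := sP y By.
have sum2 (c : 'rV[Cplx R]_2) :
    \sum_i id (c 0 i) *: s i y = c 0 0 *: s 0 y + c 0 1 *: s 1 y.
  by rewrite big_ord_recl big_ord1; congr (_ + c 0 _ *: s _ y); exact: val_inj.
have Tlin a b : tangent S y (a *: s 0 y + b *: s 1 y).
  by have [c [<- <-]] := row2 a b; rewrite -sum2; exact: Alin.
have Tspan v : tangent S y v -> exists a b, v = a *: s 0 y + b *: s 1 y.
  by move=> /Aspan[c [vc _]]; exists (c 0 0), (c 0 1); rewrite -sum2.
(* Independence comes from uniqueness of the coordinates of the zero vector. *)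
have Tfree a b : a *: s 0 y + b *: s 1 y = 0 -> a = 0 /\ b = 0.
  move=> ab0; have [c [ca cb]] := row2 a b.
  have := Tlin 0 0; rewrite !scale0r addr0 => /Aspan[c' [_ uniq]].
  have c'0 : c' = 0 by apply: uniq; rewrite sum2 !mxE !scale0r addr0.
  have c'c : c' = c by apply: uniq; rewrite sum2 ca cb ab0.
  by rewrite -ca -cb -c'c c'0 !mxE.
have eN0 : e != 0 by rewrite gt_eqF.
have Su := transverse_sphere eN0 ye (Ytr y Yy).
have Suh : exists2 u, tangent S y u & herm u y != 0.
  by have [u Tu uy] := Su; exists u => //; apply: contraNneq uy; rewrite /dot => ->.
have [w0 wP] := hyperplane_frame Tlin Tspan Tfree Suh; rewrite -wE in w0 wP.
have TS v : tangent Y y v <-> tangent S y v /\ dot v y = 0.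
  by rewrite YE; exact: tangent_linkP subm ye Su.
(* If [v] and [v'] are tangent to [Y] and [v = i v'], then [dot v y] and [dot v' y] are the real and
   imaginary parts of [herm v y], so both vanish. Conversely, the witness is [v' = - i v]. *)
have xiP v : xi_can Y y v <-> exists g : Cplx R, v = g *: w y.
  rewrite -wP; split.
    move=> [/TS[Sv vy] [v' /TS[_ v'y] vE]]; split=> //.
    rewrite [herm v y]reim -/(dot v y) vy rc0 add0r -vE hermZl.
    by rewrite im_mulI -/(dot v' y) v'y rc0 mulr0.
  move=> [Sv vy]; split; first by apply/TS; split=> //; rewrite /dot vy.
  exists (- 'i *: v); last by rewrite scalerA mulrN -expr2 sqrCi opprK scale1r.
  apply/TS; split; last by rewrite /dot hermZl vy mulr0.
  have [a [b ->]] := Tspan v Sv.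
  by rewrite scalerDr !scalerA; exact: Tlin.
(* Real combinations of [w] and [i w] are the complex multiples of [w], so the coordinates of [g w]
   are the real and imaginary parts of [g]. *)
have fsum (c : 'rV[R]_2) : \sum_i rc (c 0 i) *: frame i y =
    (rc (c 0 0) + 'i * rc (c 0 1)) *: w y.
  rewrite big_ord_recl big_ord1 /frame /= scalerDl; congr (_ + _).
  rewrite /scaler mxE scalerA mulrC; congr (_ * rc (c 0 _) *: _); exact: val_inj.
split=> [c|v /xiP[g vg]].
  by apply/xiP; exists (rc (c 0 0) + 'i * rc (c 0 1)); rewrite fsum.
have [c [cre cim]] := row2 (re g) (im g).
exists c; split; first by rewrite fsum cre cim -reim.
move=> c'; rewrite fsum vg => /eqP.
rewrite -subr_eq0 -scalerBl scaler_eq0 (negPf w0) orbF subr_eq0 => /eqP gc'.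
apply/rowP => i; have [->|i0] := eqVneq i 0.
  by rewrite cre gc' reD re_rc re_mulI im_rc oppr0 addr0.
have -> : i = 1 by apply: val_inj; case: i i0 => -[|[]].
by rewrite cim gc' imD im_rc im_mulI re_rc add0r.
Unshelve. all: by end_near. Qed.
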